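(* Let $P_n^m$ be the winning probability of the $m$-th player ($1\le m\le n$) in Game I (the sequential Showcase Showdown game with unlimited spins) with $n$ players, when all players follow the optimal policy (the next player, when $r$ players are still to play and the maximum previous score is $M_r$, uses the threshold $\max\{\theta_r,M_r\}$). Then $$P_n^m=\begin{cases} e^{\theta_n}\left(1-e^{\theta_n}+e^{\theta_n}\theta_n\right)^{n-1} & \text{if } m=1,\\[0.5em] \left(1-e^{\theta_n}+e^{\theta_n}\theta_n\right)P_{n-1}^{m-1}+e^{\theta_n}\displaystyle\int_{\theta_n}^1F_{n-1}^{m-1}(t)\,dt & \text{if } m\ge 2.\end{cases}$$
   Context: Game I: there are players $A_1,\dots,A_n$, who take their turns in this order, each having one turn. In his turn, player $A_i$ starts with $S(A_i)=0$ and successively draws independent values from the uniform distribution on $[0,1]$, adding each value to $S(A_i)$, until either he decides to stop or $S(A_i)>1$. If he stops with $S(A_i)\le1$, his score is $S(A_i)$; otherwise his score is irrevocably set to $0$. All draws of all players are independent, and each player knows the scores of all previous players. The winner is the player with the greatest score; there is a draw (no winner) if all scores are $0$. Using the threshold $\tau\in[0,1]$ means: make at least one draw and keep drawing until the accumulated total is at least $\tau$, then stop (the score is $0$ if the total then exceeds $1$). For each integer $r\ge1$, $\theta_r$ denotes the unique solution $x\in[0,1]$ of $\left(1-e^{x}+xe^{x}\right)^{r-1}=\int_x^1\left(1-e^{t}+te^{t}\right)^{r-1}dt$ (with the convention $0^0=1$, so $\theta_1=0$). Optimal policy: when $r$ players are still to play and $M_r$ is the maximum score of those who have already played ($M_r=0$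 if there are none), the next player uses the threshold $\max\{\theta_r,M_r\}$. For $1\le r<n$, $1\le m\le r$ and $x\in[\theta_r,1]$, $F_r^m(x)$ denotes the probability that the $(n-r+m)$-th player wins, given that the maximum score of the first $n-r$ players is $x$ and that all remaining players follow the optimal policy (this depends only on $r$, $m$, $x$: it is the probability that the $m$-th of the $r$ remaining players wins). *)

(* Defs.v *)
(* Written in MathComp / MathComp-Analysis, over an arbitrary realType. *)
From HB Require Import structures.
From mathcomp Require Import all_boot all_order all_algebra.
From mathcomp Require Import all_classical all_reals all_analysis.

Set Implicit Arguments.
Unset Strict Implicit.
Unset Printing Implicit Defensive.

Import Order.TTheory GRing.Theory Num.Theory.
Import numFieldNormedType.Exports.

Local Open Scope classical_set_scope.
Local Open Scope ring_scope.

Section Independence.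
Context d (T : measurableType d) (R : realType) (P : probability T R).

Definition mutually_independent (I : choiceType) (X : I -> {RV P >-> R}) :=
  forall (s : seq I) (A : I -> set R), uniq s ->
    (forall i, i \in s -> measurable (A i)) ->
    P (\bigcap_(i in [set` s]) (X i @^-1` A i)) =
    (\prod_(i <- s) P (X i @^-1` A i))%E.

Definition uniform01 (X : {RV P >-> R}) :=
  forall A : set R, measurable A ->
    distribution P X A = uniform_prob (@ltr01 R) A.

End Independence.

Section Policy.
Context (R : realType).

(* The equation defining theta_r; [^+ 0] is constantly 1, so 0^0 = 1. *)
Definition theta_spec (r : nat) (x : R) : Prop :=
  0 <= x <= 1 /\
  (1 - expR x + x * expR x) ^+ r.-1 =
  \int[lebesgue_measure]_(t in `[x, 1]) ((1 - expR t + t * expR t) ^+ r.-1).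

(* The solution of [theta_spec r] for r >= 1; the default 0 is only there to
   make the choice operator total. *)
Definition theta (r : nat) : R := xget 0 [set x | theta_spec r x].

Definition optimal_threshold (r : nat) (M : R) : R := Num.max (theta r) M.

End Policy.

Section Play.
Context (R : realType).
Implicit Types (u : nat -> R) (D : nat -> nat -> R).

Definition total u (k : nat) : R := \sum_(0 <= j < k) u j.

(* Score of a player whose successive draws are u 0, u 1, ... and who uses the
   threshold tau.  The player stops after the least k >= 1 draws whose total
   reaches tau; as tau <= 1, a total exceeding 1 also ends the turn.  A player
   who never reaches tau (a null event) is given the score 0. *)
Definition turn_score (tau : R) u : R :=
  if pselect (exists k, (0 < k)%N && (tau <= total u k)) is left h then
    let s := total u (ex_minn h) in if s <= 1 then s else 0
  else 0.

(* Scores, in playing order, of the r players still to play when the maximum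
   previous score is M; D i j is draw number j of the i-th of them (both
   counted from 0). *)
Fixpoint scores (r : nat) (M : R) D : seq R :=
  if r is r'.+1 then
    let s := turn_score (optimal_threshold r M) (D 0%N) in
    s :: scores r' (Num.max M s) (fun i => D i.+1)
  else [::].

(* The game resumes after any k players from the maximum score so far. *)
Lemma scores_add (k r : nat) (M : R) D :
  exists2 s : seq R, size s = k &
    scores (k + r) M D =
      s ++ scores r (foldl Num.max M s) (fun i => D (k + i)%N).
Proof.
elim: k M D => [|k IH] M D; first by exists [::].
rewrite addSn /=.
set x := turn_score _ _.
have [s ss ->] := IH (Num.max M x) (fun i => D i.+1).
by exists (x :: s); rewrite /= ?ss.
Qed.

(* M is the maximum score of the previous players and ss lists the scores of
   the remaining ones: the m-th of these (m >= 1) has the greatest score of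
   all.  As M >= 0, a score of 0 never wins. *)
Definition wins (M : R) (ss : seq R) (m : nat) : Prop :=
  M < nth 0 ss m.-1 /\
  forall j, (j < size ss)%N -> j != m.-1 -> nth 0 ss j < nth 0 ss m.-1.

End Play.

Section WinningProbabilities.
Context d (T : measurableType d) (R : realType) (P : probability T R).
Variable U : nat * nat -> {RV P >-> R}.

(* F_r^m(x): probability that the m-th of the r remaining players wins when
   the maximum previous score is x; U (i, j) is draw number j of the i-th of
   these players (both counted from 0). *)
Definition F (r m : nat) (x : R) : R :=
  fine (P [set w | wins x (scores r x (fun i j => U (i, j) w)) m]).

(* P_n^m: nobody has played yet, so the maximum previous score is 0. *)
Definition Pwin (n m : nat) : R :=
  fine (P [set w | wins 0 (scores n 0 (fun i j => U (i, j) w)) m]).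

End WinningProbabilities.

(* Main.v *)
(* Condition on the first turn.  Write g x = 1 - e^x + x e^x.  In a turn with
   threshold tau, the total is still below tau after k draws with probability
   tau^k / k!, and the next draw then brings it into A, a subset of [tau, 1],
   with probability the Lebesgue measure of A.  Summing over k, the score has
   density e^tau on [tau, 1] and an atom of mass g tau at 0.  The later draws
   are independent of this turn and distributed as the original ones, so
   Fubini's theorem integrates over the first score.  For m >= 2 this is the
   claimed recursion.  For m = 1, theta_r is nondecreasing in r, so once the
   first player has scored t >= theta_n all the others use the threshold t and
   each of them busts with probability g t; the equation defining theta_n then
   evaluates e^theta_n times the integral of (g t)^(n-1) over [theta_n, 1]. *)
Require Import Defs.
From HB Require Import structures.
From mathcomp Require Import all_boot all_order all_algebra.
From mathcomp Require Import all_classical all_reals all_analysis.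
From mathcomp Require Import measurable_realfun ring lra.

Set Implicit Arguments.
Unset Strict Implicit.
Unset Printing Implicit Defensive.

Import Order.TTheory GRing.Theory Num.Theory.
Import numFieldNormedType.Exports.

Local Open Scope classical_set_scope.
Local Open Scope ring_scope.

(** * Laws of i.i.d. uniform families and their uniqueness *)

Section Families.
Context {R : realType} (I : choiceType).

Definition cylinder (s : seq I) (A : I -> set R) : set (I -> R) :=
  \bigcap_(i in [set` s]) [set D : I -> R | A i (D i)].

Definition cylinders : set (set (I -> R)) :=
  [set cylinder s A | s in setT & A in [set A | forall i, measurable (A i)]].

(* A copy of [I -> R] carrying the product sigma-algebra. *)
Definition rfamily : measurableType _ := g_sigma_algebraType cylinders.

Lemma cylinder_undup (s : seq I) (A : I -> set R) :
  cylinder (undup s) A = cylinder s A.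
Proof.
by apply/seteqP; split=> D h i /= si; apply: h => /=; rewrite mem_undup in si *.
Qed.

Lemma cylindersI : setI_closed cylinders.
Proof.
move=> _ _ [s _ [A mA <-]] [t _ [B mB <-]].
exists (s ++ t) => //.
(* Off its own list each family of sets is relaxed to [setT], so the concatenated list imposes
   exactly both sets of constraints. *)
exists (fun i => (if i \in s then A i else setT) `&`
                 (if i \in t then B i else setT)).
  by move=> i /=; apply: measurableI; case: ifP.
apply/seteqP; split=> [D h|D [hs ht] i /=].
  by split=> i /= si; have := h i; rewrite /= mem_cat si ?orbT => /(_ isT) [];
    rewrite ?si.
by rewrite mem_cat => _; split; case: ifP => // ?; [exact: hs|exact: ht].
Qed.

Lemma measurable_rfamily d (T : measurableType d) (f : T -> rfamily) :
  (forall i, measurable_fun setT (fun w => f w i)) -> measurable_fun setT f.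
Proof.
move=> mf; apply: (@measurability _ _ T rfamily setT f cylinders) => //.
move=> _ [_ [s _ [A mA <-]] <-].
rewrite setTI /cylinder preimage_bigcap.
apply: fin_bigcap_measurable => [|i _]; first exact: finite_seq.
rewrite -[X in measurable X]setTI.
exact: (mf i).
Qed.

Lemma measurable_proj i : measurable_fun setT (fun D : rfamily => D i).
Proof.
move=> _ A mA; rewrite setTI; apply: sub_sigma_algebra.
exists [:: i] => //; exists (fun=> A) => //.
by apply/seteqP; split=> D /=; [apply; exact: mem_head|
  move=> h j /=; rewrite inE => /eqP->].
Qed.

(** This describes the product of uniform laws by its values on cylinders. A plain set function is
    allowed, so that the predicate applies to a [pushforward] as it stands. *)
Definition iid_uniform (mu : set rfamily -> \bar R) :=
  forall (s : seq I) (A : I -> set R), uniq s -> (forall i, measurable (A i)) ->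
    mu (cylinder s A) = (\prod_(i <- s) uniform_prob (@ltr01 R) (A i))%E.

(** Cylinders generate the sigma-algebra and are closed under intersection; the cylinder over the
    empty list is the whole space and provides the finite mass. *)
Lemma iid_uniform_unique (mu nu : {measure set rfamily -> \bar R}) :
  iid_uniform mu -> iid_uniform nu ->
  forall B, measurable B -> mu B = nu B.
Proof.
move=> imu inu; have cylT : cylinder [::] (fun=> setT) = setT.
  by apply/seteqP; split.
apply: (@measure_unique _ _ rfamily cylinders (fun=> setT)) => //.
- exact: cylindersI.
- by move=> _; exists [::] => //; exists (fun=> setT) => //; exact: cylT.
- by rewrite bigcup_const//; exists 0%N.
- move=> _ [s _ [A mA <-]].
  by rewrite -cylinder_undup imu ?inu// undup_uniq.
- by move=> _; rewrite -cylT imu// big_nil ltry.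
Qed.

End Families.

(** * Splitting a family into two independent blocks *)

Section Join.
Context {R : realType} (I J K : choiceType).
Variables (split : I -> J + K) (unsplit : J + K -> I).
Hypothesis splitK : cancel split unsplit.

Definition join (p : @rfamily R J * @rfamily R K) : @rfamily R I :=
  fun i => match split i with inl j => p.1 j | inr k => p.2 k end.

Let splitl i := if split i is inl j then Some j else None.
Let splitr i := if split i is inr k then Some k else None.

Lemma measurable_join : measurable_fun setT join.
Proof.
apply: measurable_rfamily => i; rewrite /join; case: split => [j|k].
  exact: (measurableT_comp (@measurable_proj R J j) measurable_fst).
exact: (measurableT_comp (@measurable_proj R K k) measurable_snd).
Qed.

(** Each constraint of a cylinder concerns only one of the two blocks, so the pullback is a
    rectangle. *)
Lemma preimage_join_cylinder (s : seq I) (A : I -> set R) :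
  join @^-1` cylinder s A =
  cylinder (pmap splitl s) (A \o unsplit \o inl) `*`
  cylinder (pmap splitr s) (A \o unsplit \o inr).
Proof.
apply/seteqP; split=> [[a b] h|[a b] [/= hl hr] i /= si].
  split=> [j|k] /=; rewrite mem_pmap => /mapP[i si];
    rewrite /splitl /splitr; have := h i si; rewrite /= /join;
    by case E: (split i) => [x|x] //= + [->]; rewrite -E splitK.
rewrite /join; case E: (split i) => [j|k] /=.
- have := hl j; rewrite /= -E splitK; apply.
  by rewrite mem_pmap; apply/mapP; exists i => //; rewrite /splitl E.
- have := hr k; rewrite /= -E splitK; apply.
  by rewrite mem_pmap; apply/mapP; exists i => //; rewrite /splitr E.
Qed.

Variables (mu : probability (@rfamily R J) R).
Variables (nu : probability (@rfamily R K) R).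
Hypotheses (imu : iid_uniform mu) (inu : iid_uniform nu).

Lemma iid_uniform_join : iid_uniform (pushforward (mu \x nu)%E join).
Proof.
move=> s A us mA; rewrite /pushforward preimage_join_cylinder.
rewrite product_measure1E; last 2 first.
- by apply: sub_sigma_algebra; exists (pmap splitl s) => //;
    exists (A \o unsplit \o inl) => // j; exact: mA.
- by apply: sub_sigma_algebra; exists (pmap splitr s) => //;
    exists (A \o unsplit \o inr) => // j; exact: mA.
transitivity ((\prod_(j <- pmap splitl s) uniform_prob (@ltr01 R)
    ((A \o unsplit \o inl) j)) * \prod_(k <- pmap splitr s)
    uniform_prob (@ltr01 R) ((A \o unsplit \o inr) k))%E.
  congr (_ * _)%E; [apply: imu|apply: inu] => [|j||k]; try exact: mA.
  - apply: (@pmap_uniq _ _ splitl (unsplit \o inl)) us => i.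
    by rewrite /splitl; case E: (split i) => [k|//] /=; rewrite -E splitK.
  - apply: (@pmap_uniq _ _ splitr (unsplit \o inr)) us => i.
    by rewrite /splitr; case E: (split i) => [//|k] /=; rewrite -E splitK.
elim: s {us} => [|i s IH] /=; first by rewrite !big_nil mule1.
rewrite big_cons -IH /splitl /splitr; case E: (split i) => [j|k] /=.
  by rewrite big_cons muleA /= -E splitK.
by rewrite big_cons muleCA /= -E splitK.
Qed.

Lemma measurable_fun_join_section (B : set (@rfamily R I)) : measurable B ->
  measurable_fun setT (fun a => nu [set b | B (join (a, b))]).
Proof.
move=> mB; have mJB : measurable (join @^-1` B).
  by rewrite -[X in measurable X]setTI; exact: measurable_join.
have := measurable_fun_xsection nu mJB; apply: eq_measurable_fun => a _ /=.
by congr (nu _); apply/seteqP; split=> b; rewrite /xsection /= inE.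
Qed.

(** By uniqueness [la] is the image under [join] of the product of [mu] and [nu], which integrates
    the measures of sections. This identity is what conditioning on a block of draws rests on. *)
Lemma iid_uniform_fubini (la : {measure set (@rfamily R I) -> \bar R}) B :
  iid_uniform la -> measurable B ->
  la B = (\int[mu]_a nu [set b | B (join (a, b))])%E.
Proof.
move=> ila mB.
pose m : {measure set (@rfamily R I) -> \bar R} :=
  pushforward (mu \x nu)%E join.
have im : iid_uniform (m measurable_join) := iid_uniform_join.
rewrite (iid_uniform_unique ila im mB) /= /pushforward /product_measure1 /=.
by apply: eq_integral => a _ /=; congr (nu _); apply/seteqP; split=> b;
  rewrite /xsection /= inE.
Qed.

End Join.

(** * Translation invariance, integrals of powers, the exponential series *)

Section RealAnalysis.
Context {R : realType}.
Local Notation leb := (@lebesgue_measure R).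

Lemma lebesgue_measure_shift (x : R) (A : set R) : measurable A ->
  leb [set t | A (x + t)] = leb A.
Proof.
move=> mA.
have ms : measurable_fun [set: measurableTypeR R]
   (+%R x : measurableTypeR R -> measurableTypeR R).
  by apply: measurable_funD => //; exact: measurable_cst.
pose m : {measure set (measurableTypeR R) -> \bar R} :=
  pushforward leb (+%R x : measurableTypeR R -> measurableTypeR R).
suff : leb A = m ms A by [].
apply: lebesgue_measure_unique => //= _ [[a b]] _ <-.
rewrite /pushforward (_ : _ @^-1` _ = `]a - x, b - x]%classic); last first.
  apply/seteqP; split=> t /=; rewrite !in_itv /= => /andP[? ?];
    by apply/andP; split; lra.
rewrite !lebesgue_measure_itv/= !lte_fin ltrD2r.
by case: ifP => // _; congr (_%:E); ring.
Qed.

Lemma integral_subX (k : nat) (tau : R) : 0 <= tau ->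
  (\int[leb]_(x in `[0%R, tau]) ((tau - x) ^+ k / k`!%:R)%:E =
   (tau ^+ k.+1 / k.+1`!%:R)%:E)%E.
Proof.
(* For [tau = 0] the interval is a point; the fundamental theorem below is applied on a
   nondegenerate one. *)
rewrite le_eqVlt => /predU1P[<-|tau0].
  by rewrite set_itv1 integral_set1 expr0n mul0r.
have h (x : R) : is_derive x (1 : R)
    (fun y => - ((tau - y) ^+ k.+1 / k.+1`!%:R)) ((tau - x) ^+ k / k`!%:R).
  have -> : (fun y => - ((tau - y) ^+ k.+1 / k.+1`!%:R)) =
      (- (k.+1`!%:R^-1)) \*: ((fun y : R => (tau - y)) ^+ k.+1).
    by apply/funext => y; rewrite /= !fctE /GRing.scale/=; ring.
  apply: is_derive_eq.
  rewrite /GRing.scale/= factS natrM; field.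
  by rewrite nat1r !pnatr_eq0 -lt0n fact_gt0.
rewrite (@continuous_FTC2 _ (fun x => (tau - x) ^+ k / k`!%:R)
  (fun y => - ((tau - y) ^+ k.+1 / k.+1`!%:R))) //=.
- by rewrite subrr expr0n mul0r oppr0 -EFinB sub0r opprK addr0.
- apply: continuous_subspaceT => x.
  apply: cvgMl.
  apply: (@cvg_comp _ _ _ (fun y : R => tau - y) (fun x => x ^+ k)).
    by apply: cvgB; [exact: cvg_cst|exact: cvg_id].
  exact: exprn_continuous.
- have c : continuous (fun y : R => - ((tau - y) ^+ k.+1 / k.+1`!%:R)).
    by move=> y; apply/differentiable_continuous/derivable1_diffP; case: (h y).
  split; first by move=> x _; case: (h x).
    by apply: cvg_at_right_filter; exact: c.
  by apply: cvg_at_left_filter; exact: c.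
- by move=> x _; rewrite derive1E; apply: derive_val.
Qed.

Lemma eseries_exp_coeff (x : R) : 0 <= x ->
  (\sum_(0 <= k <oo) (x ^+ k / k`!%:R)%:E = (expR x)%:E)%E.
Proof.
move=> x0; rewrite /expR -EFin_lim; last exact: is_cvg_series_exp_coeff.
by apply: congr_lim; apply/funext => n; rewrite /= sumEFin.
Qed.

End RealAnalysis.

Lemma measurable_predicate d (T : measurableType d) (f : T -> bool) :
  measurable_fun setT f -> measurable [set x | f x].
Proof.
move=> mf; rewrite -[X in measurable X]setTI.
exact: (mf measurableT [set true]).
Qed.

(** * First passage of the running total over the threshold *)

Section FirstPassage.
Context {R : realType}.

Definition scons (x : R) (u : nat -> R) : nat -> R :=
  fun n => if n is n'.+1 then u n' else x.

Lemma total_scons x u k : Defs.total (scons x u) k.+1 = x + Defs.total u k.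
Proof. by rewrite /Defs.total big_nat_recl. Qed.

(* The total first reaches tau with draw number k + 1, and then lies in A. *)
Definition passage (k : nat) (tau : R) (A : set R) : set (nat -> R) :=
  [set u | [/\ forall j, (j < k)%N -> Defs.total u j.+1 < tau,
              tau <= Defs.total u k.+1 & A (Defs.total u k.+1)]].

Lemma passage0_scons tau A x u :
  passage 0 tau A (scons x u) <-> tau <= x /\ A x.
Proof.
rewrite /passage /= total_scons /Defs.total big_nil addr0.
by split=> [[]//|[]]; split.
Qed.

Lemma passageS_scons k tau A x u :
  passage k.+1 tau A (scons x u) <->
  x < tau /\ passage k (tau - x) [set t | A (x + t)] u.
Proof.
rewrite /passage /= total_scons lerBlDl; split=> [[h1 h2 h3]|[h [h1 h2 h3]]].
  split.
    by have := h1 0%N isT; rewrite total_scons /Defs.total big_nil addr0.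
  split=> // j jk; have := h1 j.+1 jk; rewrite total_scons; lra.
split=> // -[_|j jk]; first by rewrite total_scons /Defs.total big_nil addr0.
by rewrite total_scons; have := h1 j jk; lra.
Qed.

Lemma turn_score_passage k tau u : passage k tau [set t | t <= 1] u ->
  turn_score tau u = Defs.total u k.+1.
Proof.
move=> [h1 h2 /= h3]; rewrite /turn_score; case: pselect => [h|[]]; last first.
  by exists k.+1.
case: ex_minnP => n /andP[n0 hn] nmin.
have -> : n = k.+1; last by rewrite h3.
apply/eqP; rewrite eqn_leq nmin//=; case: n n0 hn {nmin} => // n _ hn.
by rewrite ltnS leqNgt; apply/negP => /h1; rewrite ltNge hn.
Qed.

(** Either the total never reaches [tau], or it exceeds 1 when it first does. *)
Lemma turn_score_no_passage tau u :
  (forall k, ~ passage k tau [set t | t <= 1] u) -> turn_score tau u = 0.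
Proof.
move=> h; rewrite /turn_score; case: pselect => // e.
case: ex_minnP => -[|n]; first by case/andP.
move=> /andP[_ hn] nmin; case: ifP => // le1; case: (h n); split=> // j jn.
rewrite ltNge; apply/negP => hj.
by have := nmin j.+1 hj; rewrite ltnS leqNgt jn.
Qed.

(** All turns without a passage at a total of at most 1 score 0, hence the second piece when [C]
    contains 0. This reduces the law of the score to passage probabilities. *)
Lemma preimage_turn_score tau (C : set R) :
  turn_score tau @^-1` C =
  \bigcup_k passage k tau (C `&` [set t | t <= 1]) `|`
  (if 0 \in C then ~` \bigcup_k passage k tau [set t | t <= 1] else set0).
Proof.
apply/seteqP; split=> u /=.
  have [[k pk]|np] := pselect (exists k, passage k tau [set t | t <= 1] u).
    rewrite (turn_score_passage pk) => Ct; left; exists k => //.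
    by case: pk.
  rewrite turn_score_no_passage; last by move=> k pk; apply: np; exists k.
  by move=> C0; right; rewrite mem_set//= => -[k _ pk]; apply: np; exists k.
case=> [[k _ [h1 h2 [h3 h4]]]|].
  by rewrite (@turn_score_passage k).
case: ifPn => //; rewrite inE => C0 np.
by rewrite turn_score_no_passage// => k pk; apply: np; exists k.
Qed.

Lemma trivIset_passage tau A : trivIset setT (fun k => passage k tau A).
Proof.
move=> i j _ _ [u [[hi ti Ai] [hj tj Aj]]].
have [ij|ji|//] := ltngtP i j.
- by have := hj _ ij; rewrite ltNge ti.
- by have := hi _ ji; rewrite ltNge tj.
Qed.

Lemma measurable_total k :
  measurable_fun setT (fun u : @rfamily R nat => Defs.total u k).
Proof.
rewrite /Defs.total; apply: measurable_sum => j; exact: measurable_proj.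
Qed.

(** The threshold is a variable here, since in the game it depends on earlier scores. *)
Lemma measurable_passage_pair k A : measurable A ->
  measurable [set p : R * @rfamily R nat | passage k p.1 A p.2].
Proof.
move=> mA; have mt j : measurable_fun setT (fun p : R * @rfamily R nat =>
    Defs.total p.2 j).
  exact: (measurableT_comp (measurable_total j) measurable_snd).
rewrite (_ : mkset _ =
  \bigcap_(j in [set j | (j < k)%N]) [set p | Defs.total p.2 j.+1 < p.1] `&`
  ([set p | p.1 <= Defs.total p.2 k.+1] `&`
   (fun p => Defs.total p.2 k.+1) @^-1` A)); last first.
  by apply/seteqP; split=> p /=; [case|case=> ? []].
apply: measurableI; last apply: measurableI.
- apply: bigcap_measurableType => j _.
  by apply: measurable_predicate; exact: measurable_fun_ltr.
- by apply: measurable_predicate; exact: measurable_fun_ler.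
- by rewrite -[X in measurable X]setTI; exact: (mt k.+1).
Qed.

Lemma measurable_passage k tau A : measurable A ->
  measurable (passage k tau A : set (@rfamily R nat)).
Proof.
move=> mA; have /(measurable_xsection tau) := measurable_passage_pair k mA.
by congr (measurable _); apply/seteqP; split=> u; rewrite /xsection /= inE.
Qed.

Lemma measurable_turn_score :
  measurable_fun setT (fun p : R * @rfamily R nat => turn_score p.1 p.2).
Proof.
have m1 : measurable [set t : R | t <= 1].
  by rewrite -set_itvNyc; exact: measurable_itv.
move=> _ C mC; rewrite setTI.
rewrite (_ : _ @^-1` C =
  \bigcup_k [set p : R * @rfamily R nat |
              passage k p.1 (C `&` [set t | t <= 1]) p.2] `|`
  (if 0 \in C then
    ~` \bigcup_k [set p : R * @rfamily R nat |
              passage k p.1 [set t | t <= 1] p.2] else set0)); last first.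
  apply/seteqP; split=> -[tau u]; have := preimage_turn_score tau C.
    move=> /(congr1 (fun B => B u)) /= E.
    by rewrite E; case: ifP.
  move=> /(congr1 (fun B => B u)) /= E.
  by rewrite E; case: ifP.
apply: measurableU.
  apply: bigcupT_measurable => k; apply: measurable_passage_pair.
  exact: measurableI.
case: ifP => // _; apply: measurableC; apply: bigcupT_measurable => k.
exact: measurable_passage_pair.
Qed.

End FirstPassage.

(** * A single uniform draw as a family *)

Section UnitFamily.
Context {R : realType}.

(** Indexing one draw by [unit] lets it be split off by the same Fubini identity as a whole row of
    draws. *)
Definition cst_rfamily (x : measurableTypeR R) : @rfamily R unit := fun=> x.

Lemma measurable_cst_rfamily : measurable_fun setT cst_rfamily.
Proof. by apply: measurable_rfamily => i; exact: measurable_id. Qed.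

HB.instance Definition _ :=
  isMeasurableFun.Build _ _ _ _ cst_rfamily measurable_cst_rfamily.

Definition uniform_unit : probability (@rfamily R unit) R :=
  distribution (uniform_prob (@ltr01 R)) cst_rfamily.

Lemma iid_uniform_unit : iid_uniform uniform_unit.
Proof.
move=> [|[] [|[] s]] A us mA; last by [].
  rewrite big_nil -(probability_setT uniform_unit); congr (uniform_unit _).
  by apply/seteqP; split.
rewrite big_seq1 /uniform_unit /= /distribution /pushforward.
congr (uniform_prob _ _); apply/seteqP; split=> x /=.
  by move/(_ tt); apply; exact: mem_head.
by move=> Ax [].
Qed.

End UnitFamily.

(** * The law of the score of one turn *)

Section ScoreLaw.
Context {R : realType}.
Local Notation leb := (@lebesgue_measure R).
Variables (la : probability (@rfamily R nat) R) (ila : iid_uniform la).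

Let split (n : nat) : unit + nat := if n is n'.+1 then inr n' else inl tt.
Let unsplit (s : unit + nat) : nat := if s is inr n then n.+1 else 0%N.
Let splitK : cancel split unsplit. Proof. by case. Qed.

(** Index 0 is one block and the successors are the other; the shifted draws have the law [la]
    again. *)
Lemma iid_uniform_scons (B : set (@rfamily R nat)) : measurable B ->
  (la B = \int[leb]_(x in `[0%R, 1%R]) la [set u | B (scons x u)])%E.
Proof.
move=> mB; rewrite (iid_uniform_fubini splitK iid_uniform_unit ila ila mB).
have mF := measurable_fun_join_section split la mB.
rewrite ge0_integral_distribution//.
rewrite integral_uniform//; last first.
  exact: (measurableT_comp mF measurable_cst_rfamily).
rewrite subr0 invr1 mul1e; apply: eq_integral => x _ /=.
congr (la _); apply/seteqP; split=> u /=; congr (B _);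
  by apply/funext => -[].
Qed.

(* A first draw x < tau leaves the same event with k - 1, tau - x and A - x, so
   the induction integrates (tau - x)^(k-1) / (k-1)! over [0, tau]. *)
Lemma passage_prob k tau (A : set R) : 0 <= tau <= 1 -> measurable A ->
  A `<=` `[tau, 1]%classic ->
  la (passage k tau A) = (leb A * (tau ^+ k / k`!%:R)%:E)%E.
Proof.
elim: k tau A => [|k IH] tau A /andP[tau0 tau1] mA AI.
  rewrite expr0 fact0 divr1 mule1 iid_uniform_scons; last first.
    exact: measurable_passage.
  transitivity (\int[leb]_(x in `[0%R, 1%R]) (\1_A x)%:E)%E.
    apply: eq_integral => x _; rewrite indicE.
    have [xA|xA] := boolP (x \in A).
      rewrite (_ : [set u | _] = setT) ?probability_setT//.
      apply/seteqP; split=> // u _ /=; apply/passage0_scons.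
      by move: xA; rewrite inE => xA; split=> //; move/AI: xA => /= /itvP ->.
    rewrite (_ : [set u | _] = set0) ?measure0//.
    apply/seteqP; split=> // u /= /passage0_scons[_].
    by move=> Ax; move: xA; rewrite notin_setE.
  rewrite integral_indic// setIidl// => x /AI /=.
  rewrite !in_itv /= => /andP[? ->].
  by rewrite andbT (le_trans tau0).
rewrite iid_uniform_scons; last exact: measurable_passage.
(* A first draw of at least [tau] is itself the passage, so only [x < tau] contributes. *)
transitivity (\int[leb]_(x in `[0%R, 1%R])
   ((fun x => leb A * ((tau - x) ^+ k / k`!%:R)%:E) \_ `[0%R, tau[) x)%E.
  apply: eq_integral => x; rewrite inE /= in_itv /= => /andP[x0 x1].
  rewrite patchE; case: ifPn;
    rewrite ?notin_setE ?inE /= in_itv /= x0 /=.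
    move=> xtau; rewrite (_ : [set u | _] =
        passage k (tau - x) [set t | A (x + t)]); last first.
      apply/seteqP; split=> u /=; first by move=> /passageS_scons[].
      by move=> ?; apply/passageS_scons.
    rewrite IH.
    - by rewrite lebesgue_measure_shift.
    - by apply/andP; split; lra.
    - have ms : measurable_fun setT (cst x \+ @id R).
        by apply: measurable_funD; [exact: measurable_cst|exact: measurable_id].
      by have := ms measurableT A mA; rewrite setTI.
    - move=> t /AI /=; rewrite !in_itv /= => /andP[? ?].
      by apply/andP; split; lra.
  move=> xtau; rewrite (_ : [set u | _] = set0) ?measure0//.
  by apply/seteqP; split=> // u /= /passageS_scons[/xtau].
rewrite -integral_mkcondr.
rewrite (_ : _ `&` _ = `[0%R, tau[%classic); last first.
  apply/seteqP; split=> x /=; rewrite !in_itv /=.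
    by case.
  by move=> /andP[? ?]; split; apply/andP; split; lra.
have mX : measurable_fun setT (fun x : R => ((tau - x) ^+ k / k`!%:R)%:E).
  apply/measurable_EFinP; apply: measurable_funM; last exact: measurable_cst.
  by apply: measurable_funX; apply: measurable_funB.
rewrite integral_itv_bndo_bndc; last first.
  by apply: measurable_funTS; apply: emeasurable_funM.
rewrite ge0_integralZl//; last 2 first.
- exact: measurable_funTS.
- move=> x /=; rewrite in_itv /= => /andP[x0 xtau].
  by rewrite lee_fin divr_ge0// exprn_ge0// subr_ge0.
by rewrite integral_subX.
Qed.

(** Passages with different [k] are disjoint, and the weights tau^k / k! sum to e^tau. *)
Lemma passage_ever_prob tau (A : set R) : 0 <= tau <= 1 -> measurable A ->
  A `<=` `[tau, 1]%classic ->
  la (\bigcup_k passage k tau A) = ((expR tau)%:E * leb A)%E.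
Proof.
move=> tau01 mA AI; rewrite measure_bigcup//; last 2 first.
- by move=> k _; exact: measurable_passage.
- by apply: trivIset_passage.
(* Finiteness makes [leb A] a real factor that can be taken out of the series. *)
have fA : leb A \is a fin_num.
  rewrite ge0_fin_numE//; apply: (@le_lt_trans _ _ (leb `[tau, 1])).
    by apply: le_measure => //; rewrite inE//; exact: measurable_itv.
  by rewrite /= lebesgue_measure_itv/=; case: ifP => // _; rewrite -EFinB ltry.
rewrite -(eseries_exp_coeff (proj1 (andP tau01))) muleC.
rewrite -(fineK fA) -nneseriesZl//; last first.
  by move=> k _; case/andP: tau01 => ? _; rewrite lee_fin divr_ge0// exprn_ge0.
rewrite [LHS](@eq_eseriesl _ _ xpredT); last by move=> k; rewrite in_setT.
by apply: eq_eseriesr => k _; rewrite fineK// -passage_prob.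
Qed.

(** A passage at a total of at most 1 lands in [tau, 1]; the remaining probability, 1 - e^tau (1 -
    tau), sits at 0. *)
Lemma turn_score_law (tau : R) (C : set R) : 0 <= tau <= 1 -> measurable C ->
  la [set u | C (turn_score tau u)] =
  ((1 - expR tau + tau * expR tau)%:E * (\1_C (0 : R))%:E +
   (expR tau)%:E * leb (`[tau, 1%R]%classic `&` C))%E.
Proof.
move=> tau01 mC; have [tau0 tau1] := andP tau01.
have passageE (B : set R) : \bigcup_k passage k tau (B `&` [set t | t <= 1]) =
    \bigcup_k passage k tau (`[tau, 1]%classic `&` B).
  apply: eq_bigcupr => k _; apply/seteqP; split=> u [h1 h2 [h3 h4]]; split=> //.
    by split=> //=; rewrite in_itv /= h2.
  by split=> //; move: h3; rewrite /= in_itv /= h2.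
have mI (B : set R) : measurable B -> measurable (`[tau, 1]%classic `&` B).
  by move=> mB; exact: measurableI.
have mP (B : set R) : measurable B ->
    measurable (\bigcup_k passage k tau (`[tau, 1]%classic `&` B) :
                  set (@rfamily R nat)).
  move=> mB; apply: bigcupT_measurable => k.
  by apply: measurable_passage; exact: mI.
have := preimage_turn_score tau C; rewrite /preimage => ->.
rewrite -[X in ~` \bigcup_k passage k tau X]setTI !passageE indicE.
rewrite addeC -passage_ever_prob//; last exact: mI.
case: ifPn => C0 /=; last by rewrite setU0 mule0 adde0.
rewrite measureU//; [|exact: mP|by apply: measurableC; exact: mP|]; last first.
  rewrite -subset0 => u [[k _ [h1 h2 [h3 h4]]]]; apply.
  by exists k => //; split=> //; split.
rewrite mule1; congr (_ + _)%E.
rewrite [LHS]probability_setC; last exact: mP.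
rewrite setIT passage_ever_prob//= lebesgue_measure_itv /= lte_fin.
(* At [tau = 1] the formula for the length of an interval takes its degenerate branch. *)
rewrite le_eqVlt in tau1; case/predU1P: tau1 => [->|tau1].
  by rewrite ltxx mule0 sube0 mul1r subrK.
rewrite tau1 -[X in (_ * X)%E]EFinD -EFinM -EFinB; congr (_%:E); ring.
Qed.

End ScoreLaw.

(* The probability of scoring 0 with a threshold x in [0, 1]. *)
Definition bust {R : realType} (x : R) : R := 1 - expR x + x * expR x.

(** This is 1 - x <= e^(-x), multiplied by e^x. *)
Lemma bust_ge0 {R : realType} (x : R) : 0 <= bust x.
Proof.
have h : (1 - x) * expR x <= 1.
  rewrite -ler_pdivlMr ?expR_gt0// mul1r -expRN.
  by have := expR_ge1Dx (- x).
by rewrite /bust; lra.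
Qed.

Lemma continuous_bust {R : realType} : continuous (@bust R).
Proof.
move=> x; apply: (@cvgD _ R^o).
  apply: (@cvgB _ R^o); [exact: cvg_cst|exact: continuous_expR].
by apply: cvgM; [exact: cvg_id|exact: continuous_expR].
Qed.

Lemma measurable_bust {R : realType} : measurable_fun setT (@bust R).
Proof. by apply: continuous_measurable_fun; exact: continuous_bust. Qed.

Lemma measurable_bustX {R : realType} k :
  measurable_fun setT (fun t : R => (bust t ^+ k)%:E).
Proof.
by apply/measurable_EFinP; apply: measurable_funX; exact: measurable_bust.
Qed.

(** * Expectations of functions of the score *)

Section ScoreIntegral.
Context {R : realType}.
Local Notation leb := (@lebesgue_measure R).

Lemma ge0_integral_mrestr (D : set (measurableTypeR R)) (mD : measurable D)
    (f : R -> \bar R) :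
  measurable_fun setT f -> (forall t, 0 <= f t)%E ->
  (\int[mrestr leb mD]_t f t = \int[leb]_(t in D) f t)%E.
Proof.
move=> mf f0; rewrite -(setUv D) ge0_integral_setU//; last 3 first.
- exact: measurableC.
- exact: measurable_funTS.
- by rewrite disj_set2E setICr.
rewrite [X in (_ + X)%E]null_set_integral ?adde0//=.
- by apply: eq_measure_integral => A _ AD; rewrite /= /mrestr setIidl.
- exact: measurableC.
- exact: measurable_funTS.
- by rewrite /mrestr setICl measure0.
Qed.

Variables (la : probability (@rfamily R nat) R) (ila : iid_uniform la).

Lemma measurable_turn_score1 tau :
  measurable_fun setT (turn_score tau : @rfamily R nat -> R).
Proof.
exact: (measurableT_comp measurable_turn_score (pair1_measurable tau)).
Qed.

(** The image of [la] under the score is a multiple of the Dirac mass at 0 plus a multiple of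
    Lebesgue measure restricted to [tau, 1]. *)
Lemma integral_turn_score (tau : R) (f : R -> \bar R) : 0 <= tau <= 1 ->
  measurable_fun setT f -> (forall t, 0 <= f t)%E ->
  (\int[la]_u f (turn_score tau u) =
   (bust tau)%:E * f 0%R +
   (expR tau)%:E * \int[leb]_(t in `[tau, 1%R]) f t)%E.
Proof.
move=> tau01 mf f0.
have mI : measurable (`[tau, 1%R]%classic : set (measurableTypeR R)).
  exact: measurable_itv.
have mts : measurable_fun setT
    (turn_score tau : @rfamily R nat -> measurableTypeR R).
  exact: measurable_turn_score1.
have mf' : measurable_fun [set: measurableTypeR R] (f : measurableTypeR R -> _).
  exact: mf.
have := ge0_integral_pushforward mts la measurableT mf'.
move=> /(_ (fun _ _ => f0 _)) /= <-.
rewrite (@eq_measure_integral _ _ _ setT (measure_add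
   (mscale (NngNum (bust_ge0 tau)) (dirac (0 : measurableTypeR R)))
   (mscale (NngNum (expR_ge0 tau)) (mrestr leb mI)))); last first.
  move=> C mC _; rewrite [LHS](turn_score_law ila tau01 mC).
  rewrite /= /measure_add /msum 2!big_ord_recl big_ord0 adde0.
  by rewrite /mscale /= /mrestr /dirac setIC.
rewrite ge0_integral_measure_add// !ge0_integral_mscale//.
by rewrite integral_dirac// diracT mul1e ge0_integral_mrestr.
Qed.

End ScoreIntegral.

(** * Winning in terms of the first remaining score *)

Section WinsCons.
Context {R : realType}.
Implicit Types (M s : R) (ss : seq R).

Lemma size_scores r M D : size (scores r M D : seq R) = r.
Proof. by elim: r M D => //= r IH M D; rewrite IH. Qed.

Lemma wins_cons1 M s ss :
  wins M (s :: ss) 1 <->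
  M < s /\ forall j, (j < size ss)%N -> nth 0 ss j < s.
Proof.
split=> -[Ms h]; split=> //.
  by move=> j js; exact: (h j.+1).
by case=> [|j] //= js _; exact: h.
Qed.

(** A later winner must strictly beat both [M] and [s], so the two merge into one previous
    maximum. *)
Lemma wins_consSS M s ss m :
  wins M (s :: ss) m.+2 <-> wins (Num.max M s) ss m.+1.
Proof.
rewrite /wins /= gt_max; split=> [[Mm h]|[/andP[Mm sm] h]].
  split; first by rewrite Mm; exact: (h 0%N).
  by move=> j js jm; exact: (h j.+1).
by split=> // -[|j] //= js jm; exact: h.
Qed.

End WinsCons.

(** * Conditioning the game on its first turn *)

Section Game.
Context {R : realType}.
Local Notation leb := (@lebesgue_measure R).
Local Notation grid := (@rfamily R (nat * nat)%type).
Local Notation rows := (fun (D : grid) i j => D (i, j)).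

Definition first_row (D : grid) : @rfamily R nat := fun j => D (0%N, j).
Definition next_rows (D : grid) : grid := fun ij => D (ij.1.+1, ij.2).

Lemma measurable_first_row : measurable_fun setT first_row.
Proof. by apply: measurable_rfamily => j; exact: measurable_proj. Qed.

Lemma measurable_next_rows : measurable_fun setT next_rows.
Proof. by apply: measurable_rfamily => j; exact: measurable_proj. Qed.

(** Measurability is joint in the previous maximum and the draws, because the induction feeds the
    first score into that maximum. *)
Lemma measurable_nth_scores r i :
  measurable_fun setT
    (fun p : R * grid => nth 0 (scores r p.1 (rows p.2)) i).
Proof.
elim: r i => [|r IH] i /=.
  by under eq_fun do rewrite nth_nil; exact: measurable_cst.
have mt : measurable_fun setT (fun p : R * grid => optimal_threshold r.+1 p.1).
  by apply: measurable_maxr; [exact: measurable_cst|exact: measurable_fst].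
have ms : measurable_fun setT (fun p : R * grid =>
    turn_score (optimal_threshold r.+1 p.1) (rows p.2 0%N)).
  apply: (measurableT_comp measurable_turn_score
    (g := fun p : R * grid => (optimal_threshold r.+1 p.1, first_row p.2))).
  apply: measurable_fun_pair => //.
  exact: (measurableT_comp measurable_first_row measurable_snd).
case: i => [|i] //=.
apply: (measurableT_comp (IH i) (g := fun p : R * grid =>
  (Num.max p.1 (turn_score (optimal_threshold r.+1 p.1) (rows p.2 0%N)),
   next_rows p.2))).
apply: measurable_fun_pair.
  by apply: measurable_maxr => //; exact: measurable_fst.
exact: (measurableT_comp measurable_next_rows measurable_snd).
Qed.

Lemma measurable_wins r m :
  measurable [set p : R * grid | wins p.1 (scores r p.1 (rows p.2)) m].
Proof.
rewrite (_ : mkset _ =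
  [set p : R * grid | p.1 < nth 0 (scores r p.1 (rows p.2)) m.-1] `&`
  \bigcap_(j in [set j | (j < r)%N /\ j != m.-1])
    [set p : R * grid | nth 0 (scores r p.1 (rows p.2)) j <
                        nth 0 (scores r p.1 (rows p.2)) m.-1]); last first.
  apply/seteqP; split=> p; rewrite /wins /= size_scores => -[h1 h2]; split=> //.
    by move=> j [/=]; exact: h2.
  by move=> j jr jm; exact: h2.
apply: measurableI.
  apply: measurable_predicate; apply: measurable_fun_ltr.
    exact: measurable_fst.
  exact: measurable_nth_scores.
apply: bigcap_measurableType => j _; apply: measurable_predicate.
by apply: measurable_fun_ltr; exact: measurable_nth_scores.
Qed.

Lemma measurable_wins_from r m (M : R) :
  measurable [set D : grid | wins M (scores r M (rows D)) m].
Proof.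
have := measurable_xsection M (measurable_wins r m).
by congr (measurable _); apply/seteqP; split=> D; rewrite /xsection /= inE.
Qed.

Variables (la : probability (@rfamily R nat) R) (Q : probability grid R).
Hypotheses (ila : iid_uniform la) (iQ : iid_uniform Q).

Let split (ij : nat * nat) : nat + nat * nat :=
  if ij.1 is i.+1 then inr (i, ij.2) else inl ij.2.
Let unsplit (s : nat + nat * nat) : nat * nat :=
  match s with inl j => (0%N, j) | inr ij => (ij.1.+1, ij.2) end.
Let splitK : cancel split unsplit. Proof. by case=> -[|i] j. Qed.

Lemma measurable_section (G : set (R * grid)) : measurable G ->
  measurable_fun setT (fun t : R => Q [set D | G (t, D)]).
Proof.
move=> mG; have := measurable_fun_xsection Q mG.
apply: eq_measurable_fun => t _ /=.
by congr (Q _); apply/seteqP; split=> b; rewrite /xsection /= inE.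
Qed.

(** Row 0 is independent of the other rows, which keep the law [Q] after renumbering; the two terms
    are the atom and the density of the first score. *)
Lemma first_turn (tau : R) (G : set (R * grid)) : 0 <= tau <= 1 ->
  measurable G ->
  (Q [set D | G (turn_score tau (first_row D), next_rows D)] =
   (bust tau)%:E * Q [set D | G (0%R, D)] +
   (expR tau)%:E * \int[leb]_(t in `[tau, 1%R]) Q [set D | G (t, D)])%E.
Proof.
move=> tau01 mG.
rewrite -(integral_turn_score ila tau01 (measurable_section mG))//.
rewrite (iid_uniform_fubini splitK ila iQ iQ); last first.
  rewrite -[X in measurable X]setTI.
  have : measurable_fun setT (fun D : grid =>
      (turn_score tau (first_row D), next_rows D)).
    apply: measurable_fun_pair; last exact: measurable_next_rows.
    exact: (measurableT_comp (measurable_turn_score1 tau) measurable_first_row).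
  by move=> /(_ measurableT G mG).
apply: eq_integral => u _; congr (Q _); apply/seteqP; split=> D /=;
  by congr (G (_, _)); apply/funext => -[].
Qed.

Lemma later_player_wins r m (M : R) : 0 <= optimal_threshold r.+1 M <= 1 ->
  (Q [set D | wins M (scores r.+1 M (rows D)) m.+2] =
   (bust (optimal_threshold r.+1 M))%:E *
     Q [set D | wins (Num.max M 0%R) (scores r (Num.max M 0%R) (rows D)) m.+1] +
   (expR (optimal_threshold r.+1 M))%:E *
   \int[leb]_(t in `[optimal_threshold r.+1 M, 1%R])
     Q [set D | wins (Num.max M t) (scores r (Num.max M t) (rows D)) m.+1])%E.
Proof.
move=> tau01.
rewrite -(@first_turn _ [set p | wins (Num.max M p.1)
  (scores r (Num.max M p.1) (rows p.2)) m.+1])//.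
  by congr (Q _); apply/seteqP; split=> D /=; rewrite wins_consSS.
have := measurable_wins r m.+1; rewrite -[X in _ -> measurable X]setTI.
have : measurable_fun setT (fun p : R * grid => (Num.max M p.1, p.2)).
  apply: measurable_fun_pair; last exact: measurable_snd.
  by apply: measurable_maxr; [exact: measurable_cst|exact: measurable_fst].
by move=> /(_ measurableT _)/[apply].
Qed.

(** The previous maximum [t] and the level [s] are separate, since a turn may raise the former while
    the latter stays fixed. *)
Definition all_below r (t : R) (s : R) (D : grid) :=
  forall j, (j < r)%N -> nth 0 (scores r t (rows D)) j < s.

Lemma measurable_all_below r (f g : R -> R) :
  measurable_fun setT f -> measurable_fun setT g ->
  measurable [set p : R * grid | all_below r (f p.1) (g p.1) p.2].
Proof.
move=> mf mg; rewrite (_ : mkset _ = \bigcap_(j in [set j | (j < r)%N])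
    [set p : R * grid | nth 0 (scores r (f p.1) (rows p.2)) j < g p.1]);
    last first.
  by apply/seteqP; split=> p.
apply: bigcap_measurableType => j _; apply: measurable_predicate.
apply: measurable_fun_ltr.
  apply: (measurableT_comp (measurable_nth_scores r j)
    (g := fun p : R * grid => (f p.1, p.2))).
  apply: measurable_fun_pair; last exact: measurable_snd.
  exact: (measurableT_comp mf measurable_fst).
exact: (measurableT_comp mg measurable_fst).
Qed.

(** Every threshold met is [t], and the resulting score is 0 or at least [t]; staying below [t > 0]
    thus means that all [r] players bust. *)
Lemma all_below_prob r (t : R) : 0 <= t <= 1 ->
  (forall j, (0 < j <= r)%N -> theta R j <= t) ->
  Q [set D | all_below r t t D] = (bust t ^+ r)%:E.
Proof.
move=> /andP[t0 t1]; elim: r => [|r IH] tht.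
  rewrite expr0 -(probability_setT Q); congr (Q _).
  by apply/seteqP; split.
have taut : optimal_threshold r.+1 t = t.
  by apply/max_idPr; apply: tht; rewrite ltnS leqnn.
transitivity (Q [set D | [set p : R * grid | p.1 < t /\
    all_below r (Num.max t p.1) t p.2]
    (turn_score t (first_row D), next_rows D)]).
  congr (Q _); apply/seteqP; split=> D.
    rewrite /all_below /= taut => h; split; first exact: (h 0%N).
    by move=> j jr; exact: (h j.+1).
  by rewrite /all_below /= taut => -[h1 h2] [|j] //=; exact: h2.
rewrite first_turn; last 2 first.
- by rewrite t0.
- apply: measurableI.
    apply: measurable_predicate; apply: measurable_fun_ltr.
      exact: measurable_fst.
    exact: measurable_cst.
  apply: (measurable_all_below r (f := Num.max t) (g := cst t)) => //.
  by apply: measurable_maxr => //; exact: measurable_id.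
rewrite [X in (_ + _ * X)%E]integral0_eq; last first.
  move=> s /=; rewrite in_itv /= => /andP[ts _].
  rewrite (_ : mkset _ = set0) ?measure0//; apply/seteqP; split=> // D /= [].
  by rewrite ltNge ts.
rewrite mule0 adde0 exprS /= (max_idPl t0).
(* At [t = 0] not even a bust is strictly below [t]; both sides vanish because [bust 0] is 0. *)
move: t0; rewrite le_eqVlt => /predU1P[<-|t0].
  by rewrite /bust expR0 mul0r addr0 subrr mul0r mul0e.
rewrite EFinM -IH; last first.
  by move=> j /andP[j0 jr]; apply: tht; rewrite j0 leqW.
by congr (_ * Q _)%E; apply/seteqP; split=> D /= => [[]|].
Qed.

(** A first score of 0 cannot win. A score t > tau wins exactly when the later players stay below
    it, and t dominates all their [theta R j]. *)
Lemma first_player_wins r (tau := theta R r.+1) : 0 <= tau <= 1 ->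
  (forall j, (0 < j <= r)%N -> theta R j <= tau) ->
  (Q [set D | wins 0%R (scores r.+1 0%R (rows D)) 1%N] =
   (expR tau)%:E * \int[leb]_(t in `[tau, 1%R]) (bust t ^+ r)%:E)%E.
Proof.
move=> /andP[tau0 tau1] tht.
have taut : optimal_threshold r.+1 0 = tau by exact/max_idPl.
transitivity (Q [set D | [set p : R * grid | 0 < p.1 /\
    all_below r (Num.max 0 p.1) p.1 p.2]
    (turn_score tau (first_row D), next_rows D)]).
  congr (Q _); apply/seteqP; split=> D;
    by rewrite /all_below /= taut wins_cons1 size_scores.
have mG : measurable [set p : R * grid | 0 < p.1 /\
    all_below r (Num.max 0 p.1) p.1 p.2].
  apply: measurableI.
    apply: measurable_predicate; apply: measurable_fun_ltr.
      exact: measurable_cst.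
    exact: measurable_fst.
  apply: (measurable_all_below r (f := Num.max 0) (g := id)) => //.
  by apply: measurable_maxr => //; exact: measurable_id.
rewrite first_turn//; last by rewrite tau0.
rewrite [X in Q X](_ : _ = set0); last first.
  by apply/seteqP; split=> // D /= []; rewrite ltxx.
rewrite measure0 mule0 add0e; congr (_ * _)%E.
(* The integrands may differ at t = 0: a first score of 0 does not win. *)
rewrite -[LHS]integral_itv_obnd_cbnd; last first.
  by apply: measurable_funTS; apply: (measurable_section mG).
rewrite -[RHS]integral_itv_obnd_cbnd; last first.
  by apply: measurable_funTS; apply: measurable_bustX.
apply: eq_integral => t; rewrite inE /= in_itv /= => /andP[taut' t1].
have t0 : 0 < t by exact: le_lt_trans taut'.
rewrite -all_below_prob ?(ltW t0)//; last first.
  by move=> j /tht /le_trans; apply; exact: ltW.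
congr (Q _); apply/seteqP; split=> D /=; rewrite (max_idPr (ltW t0)) => //.
by case.
Qed.

End Game.

(** * Existence and monotonicity of the optimal thresholds *)

Section Theta.
Context {R : realType}.
Local Notation leb := (@lebesgue_measure R).

Lemma bust0 : bust (0 : R) = 0.
Proof. by rewrite /bust expR0 mul0r addr0 subrr. Qed.

(** As [bust x] is 1 - (1 - x) e^x, the claim amounts to (1 - y) e^(y - x) < 1 - x. *)
Lemma bust_lt (x y : R) : 0 <= x -> x < y -> y <= 1 -> bust x < bust y.
Proof.
move=> x0 xy y1; set d := y - x.
have ed : expR y = expR x * expR d by rewrite -expRD /d subrKC.
have d0 : 0 < d by rewrite subr_gt0.
have h : (1 - y) * expR d < 1 - x.
  rewrite -ltr_pdivlMr ?expR_gt0// -expRN.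
  (* This product exceeds 1 - y by x d >= 0, and 1 - d < e^(-d). *)
  apply: (@le_lt_trans _ _ ((1 - x) * (1 - d))).
    by rewrite /d in d0 *; nra.
  rewrite ltr_pM2l; last by lra.
  by apply: expR_gt1Dx; rewrite oppr_eq0 gt_eqF.
have := expR_gt0 x; rewrite /bust ed; nra.
Qed.

Lemma continuous_bustX k : continuous (fun x : R => bust x ^+ k).
Proof.
move=> x; apply: (@continuous_comp _ _ _ (@bust R) (fun x => x ^+ k)).
  exact: continuous_bust.
exact: exprn_continuous.
Qed.

Lemma integrable_bustX (a b : R) k :
  leb.-integrable `[a, b] (EFin \o (fun t => bust t ^+ k)).
Proof.
apply: continuous_compact_integrable; first exact: segment_compact.
apply: continuous_subspaceT; exact: continuous_bustX.
Qed.

Lemma theta_spec_integral r (x : R) : theta_spec r x ->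
  ((bust x ^+ r.-1)%:E = \int[leb]_(t in `[x, 1%R]) (bust t ^+ r.-1)%:E)%E.
Proof.
case=> _; rewrite -!/(bust _) => ->; rewrite /Rintegral fineK//.
by apply: integrable_fin_num => //; exact: integrable_bustX.
Qed.

(** Adding the integral over [0, x] to both sides turns the equation into [K x = c]; [K] is
    continuous and runs from 0 to 1 + c, so the intermediate value theorem applies. *)
Lemma theta_spec_exists r : exists x : R, theta_spec r x.
Proof.
(* With exponent 0 the convention 0^0 = 1 spoils [K 0 = 0]; the solution is then 0 itself. *)
rewrite /theta_spec; case: r.-1 => {r} [|r].
  exists 0; split; first by rewrite lexx ler01.
  under eq_Rintegral do rewrite expr0.
  rewrite expr0 /Rintegral integral_cst//= lebesgue_measure_itv/= lte01.
  by rewrite mul1e sube0.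
set k := r.+1.
pose c := (\int[leb]_(t in `[0, 1]) (bust t ^+ k))%R.
have c0 : 0 <= c by apply: Rintegral_ge0 => t _; rewrite exprn_ge0// bust_ge0.
pose K (x : R) := bust x ^+ k + (\int[leb]_(t in `[0, x]) (bust t ^+ k))%R.
have cK : {within `[0, 1], continuous K}.
  have cX : {within `[0, 1], continuous (fun x : R => bust x ^+ k)}.
    by apply: continuous_subspaceT; exact: continuous_bustX.
  have cI := parameterized_integral_continuous ler01 (integrable_bustX 0 1 k).
  by move=> x; apply: (@cvgD _ R^o); [exact: cX|exact: cI].
have K0 : K 0 = 0.
  by rewrite /K bust0 expr0n /= set_itv1 Rintegral_set1 addr0.
have K1 : K 1 = 1 + c by rewrite /K /bust mul1r subrK expr1n.
have [|x x01 Kx] := @IVT R K 0 1 c ler01 cK.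
  by rewrite K0 K1; rewrite min_l ?max_r; lra.
exists x; split=> //; move: x01; rewrite in_itv /= => /andP[x0 x1].
rewrite -[LHS]/(bust x ^+ k).
have itg := integrable_bustX.
rewrite -[RHS]Rintegral_itv_obnd_cbnd; last first.
  by apply: integrableS (itg x 1 k) => //; exact: subset_itv_oc_cc.
have := @Rintegral_itvB R (fun t => bust t ^+ k) (BLeft 0) (BRight 1) x.
move=> /(_ (itg 0 1 k)) <-; [|by rewrite bnd_simp..].
by rewrite -/c -Kx /K addrK.
Qed.

Lemma thetaP r : theta_spec r (theta R r).
Proof. by apply: xgetPex; exact: theta_spec_exists. Qed.

Lemma theta_ge0_le1 r : 0 <= theta R r <= 1.
Proof. by case: (thetaP r). Qed.

(* If b = theta_(r+1) < a = theta_r, integrating g^r >= g(a) g^(r-1) over [a, 1]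
   gives g(a)^r <= g(b)^r, although g is increasing. *)
Lemma theta_leS r : (0 < r)%N -> theta R r <= theta R r.+1.
Proof.
case: r => // r _; rewrite leNgt; apply/negP.
set a := theta R r.+1; set b := theta R r.+2 => ba.
have /andP[b0 b1] : 0 <= b <= 1 by exact: theta_ge0_le1.
have /andP[a0 a1] : 0 <= a <= 1 by exact: theta_ge0_le1.
have gab := bust_lt b0 ba a1.
have Ea := theta_spec_integral (thetaP r.+1).
have Eb := theta_spec_integral (thetaP r.+2).
rewrite -/a -/b /= in Ea Eb.
have mg k := @measurable_bustX R k.
have g0 k (t : R) : (0 <= (bust t ^+ k)%:E)%E.
  by rewrite lee_fin exprn_ge0// bust_ge0.
have : ((bust a ^+ r.+1)%:E <= (bust b ^+ r.+1)%:E)%E.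
  rewrite exprS EFinM Ea Eb -ge0_integralZl//; last 2 first.
  - by apply: measurable_funTS; apply: mg.
  - by rewrite lee_fin bust_ge0.
  apply: (@le_trans _ _ (\int[leb]_(t in `[a, 1%R]) (bust t ^+ r.+1)%:E)%E).
    apply: ge0_le_integral => //=.
    - by move=> t _; rewrite mule_ge0// lee_fin bust_ge0.
    - apply: emeasurable_funM; first exact: measurable_cst.
      by apply: measurable_funTS; apply: mg.
    - by apply: measurable_funTS; apply: mg.
    move=> t; rewrite in_itv /= => /andP[at_ t1].
    rewrite exprS -EFinM lee_fin ler_wpM2r ?exprn_ge0 ?bust_ge0//.
    move: at_; rewrite le_eqVlt => /predU1P[->//|at_].
    exact/ltW/bust_lt.
  apply: ge0_subset_integral => //.
    by apply: measurable_funTS; apply: mg.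
  by move=> t /=; rewrite !in_itv /= => /andP[? ->]; rewrite andbT; lra.
by rewrite lee_fin leNgt ltrXn2r ?bust_ge0// gab.
Qed.

Lemma theta_le j r : (0 < j <= r)%N -> theta R j <= theta R r.
Proof.
move=> /andP[j0 /subnK <-]; elim: (r - j)%N => [|i IH] //.
by apply: (le_trans IH); apply: theta_leS; rewrite addn_gt0 j0 orbT.
Qed.

End Theta.

(** * The law of the given draws *)

Section Draws.
Context d (T : measurableType d) (R : realType) (P : probability T R).
Context (I J : choiceType) (U : I -> {RV P >-> R}) (g : J -> I).

Definition draws (w : T) : @rfamily R J := fun j => U (g j) w.

Lemma measurable_draws : measurable_fun setT draws.
Proof. by apply: measurable_rfamily => j; exact: measurable_funP. Qed.

HB.instance Definition _ :=
  isMeasurableFun.Build _ _ _ _ draws measurable_draws.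

(** The left inverse [h] carries sets indexed by [J] over to [I], where independence is assumed. *)
Lemma iid_uniform_draws (h : I -> J) : cancel g h ->
  mutually_independent U -> (forall i, uniform01 (U i)) ->
  iid_uniform (distribution P draws).
Proof.
move=> gK indep unif s A us mA; rewrite /distribution /pushforward.
have ug : uniq (map g s) by rewrite map_inj_uniq//; exact: can_inj gK.
have := indep _ (A \o h) ug (fun i _ => mA (h i)).
rewrite big_map => E.
transitivity (\prod_(j <- s) P (U (g j) @^-1` (A \o h) (g j)))%E.
  rewrite -E; congr (P _); apply/seteqP; split=> w /= H.
    by move=> _ /mapP[j js ->] /=; rewrite gK; exact: H.
  by move=> j js; have := H (g j); rewrite /= gK; apply; exact: map_f.
by apply: eq_bigr => j _; rewrite /= gK; exact: (unif (g j)).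
Qed.

End Draws.

Theorem proposition4 (R : realType) (d : measure_display)
    (T : measurableType d) (P : probability T R)
    (U : nat * nat -> {RV P >-> R})
    (U_indep : mutually_independent U)
    (U_unif : forall ij, uniform01 (U ij))
    (n m : nat) (m_range : (1 <= m <= n)%N) :
  Pwin U n m =
  if m == 1%N then
    expR (theta R n) *
    (1 - expR (theta R n) + expR (theta R n) * theta R n) ^+ n.-1
  else
    (1 - expR (theta R n) + expR (theta R n) * theta R n) *
      Pwin U n.-1 m.-1 +
    expR (theta R n) *
      \int[lebesgue_measure]_(t in `[theta R n, 1]) F U n.-1 m.-1 t.
Proof.
(* [la] is the law of the first row and [Q] that of the whole grid, so [F] and [Pwin] are
   [Q]-probabilities by unfolding. *)
pose la : probability (@rfamily R nat) R := distribution P (draws U (pair 0%N)).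
pose Q : probability (@rfamily R (nat * nat)%type) R :=
  distribution P (draws U id).
have ila : iid_uniform la by apply: (iid_uniform_draws (h := snd)).
have iQ : iid_uniform Q by apply: (iid_uniform_draws (h := id)).
case: n m_range => [|r]; first by case: m.
rewrite [_ * theta R r.+1]mulrC -/(bust _) /=.
have th01 := @theta_ge0_le1 R r.+1.
have tau0 : optimal_threshold r.+1 0 = theta R r.+1.
  by apply/max_idPl; case/andP: th01.
case: m => [//|[|m]] /= mr.
  have th j : (0 < j <= r)%N -> theta R j <= theta R r.+1.
    by move=> /andP[j0 jr]; apply: theta_le; rewrite j0 leqW.
  have := first_player_wins ila iQ th01 th.
  (* The equation defining [theta R r.+1] evaluates the integral. *)
  by rewrite -(theta_spec_integral (thetaP r.+1)) -EFinM => /(congr1 fine).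
have := @later_player_wins R la Q ila iQ r m 0.
rewrite tau0 maxxx => /(_ th01) E.
have FE t : (F U r m.+1 t)%:E = Q [set D | wins t
   (scores r t (fun i j => D (i, j))) m.+1].
  exact: (fineK (fin_num_measure Q _ (measurable_wins_from r m.+1 t))).
pose I := (\int[lebesgue_measure]_(t in `[theta R r.+1, 1%R])
             (F U r m.+1 t)%:E)%E.
have {}E : (Pwin U r.+1 m.+2)%:E =
    ((bust (theta R r.+1))%:E * (Pwin U r m.+1)%:E +
     (expR (theta R r.+1))%:E * I)%E.
  rewrite /Pwin fineK; last first.
    exact: (fin_num_measure Q _ (measurable_wins_from r.+1 m.+2 0)).
  (* After a bust the maximum is still 0, and [F] at 0 is [Pwin]. *)
  rewrite [LHS]E; congr (_ * _ + _ * _)%E; first exact/esym/(FE 0).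
  apply: eq_integral => t; rewrite inE /= in_itv /= => /andP[t0 _].
  have /max_idPr -> : 0 <= t by case/andP: th01 => h _; exact: le_trans t0.
  by rewrite FE.
(* Finiteness is read off the recursion [E]: an infinite [I], multiplied by e^theta > 0, would make
   the real left-hand side infinite. *)
have : I \is a fin_num.
  move: E; case: I => //; first by rewrite gt0_muley ?lte_fin ?expR_gt0.
  by rewrite gt0_muleNy ?lte_fin ?expR_gt0.
rewrite /Rintegral -/I => /fineK I'; move: E; rewrite -I' -!EFinM -EFinD.
by case.
Qed.
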